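(* There exist infinitely many (an infinite family of) non-log-concave pure $O$-sequences of codimension $r$ and type $t$ for each of the following pairs of integers $(r,t)$: (1) $r=3$ and $t=4$; (2) $r\ge 4$ and $t\in\{2,3,\dots,r+1\}$.
   Context: A pure $O$-sequence of codimension $r$, type $t$ and socle degree $e$ is a sequence $h=(1,h_1=r,h_2,\dots,h_e=t)$ of positive integers for which there exist $t$ distinct (monic) monomials of degree $e$ in $r$ variables such that, for every $i$ with $0\le i\le e$, the number of distinct monomials of degree $i$ dividing at least one of these $t$ monomials is $h_i$ (in particular, since $h_1=r$, every variable divides at least one of them). Equivalently, it is the Hilbert function of a level artinian standard graded algebra of codimension $r$ and type $t$ defined by a monomial ideal. A sequence $(a_n)_{n\in\mathbb N}$ is log-concave if $a_{i-1}a_{i+1}\le a_i^2$ for all indices $i\ge 1$; a pure $O$-sequence $(1,h_1,\dots,h_e)$ is regarded as such a sequence with $h_i=0$ for $i>e$. *)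

(* Defs.v *)
From mathcomp Require Import all_boot all_order all_algebra.
From mathcomp Require Import classical_sets cardinality.
From mathcomp Require Import mpoly.

Set Implicit Arguments.
Unset Strict Implicit.
Unset Printing Implicit Defensive.

(* A monomial in r variables is its exponent vector m : 'X_{1..r}; its degree
   is mdeg m, and (m <= u)%MM is divisibility.  The finite type
   'X_{1..r < e.+1} consists of the monomials of degree at most e. *)

Definition dividing_monomials (r e : nat) (M : {set 'X_{1..r < e.+1}})
    (i : nat) : {set 'X_{1..r < e.+1}} :=
  [set m : 'X_{1..r < e.+1} |
    (mdeg m == i) && [exists u in M, (m <= u)%MM]].

(* h = (h_0, ..., h_e) is a list of length e + 1, so that nth 0 h i is h_i for
   i <= e and 0 for i > e. *)
Definition is_pure_O_sequence (r t e : nat) (h : seq nat) : Prop :=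
  [/\ 0 < e,
      size h = e.+1,
      (forall i : nat, i <= e -> 0 < nth 0 h i),
      [/\ nth 0 h 0 = 1, nth 0 h 1 = r & nth 0 h e = t] &
      exists M : {set 'X_{1..r < e.+1}},
        [/\ #|M| = t,
            (forall m : 'X_{1..r < e.+1}, m \in M -> mdeg m = e) &
            (forall i : nat, i <= e ->
               nth 0 h i = #|dividing_monomials M i|)]].

Definition log_concave (a : nat -> nat) : Prop :=
  forall i : nat, 1 <= i -> a i.-1 * a i.+1 <= a i ^ 2.

Definition non_log_concave_pure_O_sequences (r t : nat) : set (seq nat) :=
  [set h : seq nat | (exists e : nat, is_pure_O_sequence r t e h) /\
                     ~ log_concave (nth 0 h)]%classic.

(* Main.v *)
Require Import Defs.
From mathcomp Require Import all_boot all_order all_algebra.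
From mathcomp Require Import classical_sets cardinality.
From mathcomp Require Import mpoly zify.

Set Implicit Arguments.
Unset Strict Implicit.
Unset Printing Implicit Defensive.

(* Take the monomial u = (x_0 x_1 x_2)^a together with monomials g x_c^N, where
   g ranges over a few fixed monomials of degree q not involving x_c, and
   3a = q + N.  For a large, in degrees 3a - k with q <= k <= q + 2, the divisors
   of u number (k + 1)(k + 2)/2, while the divisors of the other generators
   number a constant C, the number of divisors of the g's: the exponent of x_c is
   determined by the degree and exceeds a.  With T = (q + 2)(q + 3)/2 the sequence
   contains (T + q + 3 + C), (T + C), (T - q - 2 + C), which violates
   log-concavity as soon as C > T.
   For r = 3 take g = x_0 x_1 x_2 / x_c for each c, so that q = 2, T = 10, C = 12.
   For r >= 4 use only c = 3 and g a multiple of (x_0 x_1 x_2)^p, so that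
   C >= p^3 outgrows T, which is quadratic in p. *)

(** * Finite lists of monomials and their divisors *)

Lemma card_bmnm_mem r e (s : seq 'X_{1..r}) :
  uniq s -> all (fun m => mdeg m <= e) s ->
  #|[set m : 'X_{1..r < e.+1} | bmnm m \in s]| = size s.
Proof.
move=> us /allP les; rewrite cardE -(size_map (@bmnm _ _)).
apply/perm_size/uniq_perm => //.
  by rewrite map_inj_uniq ?enum_uniq //; apply: val_inj.
move=> m; apply/mapP/idP => [[x]|ms]; first by rewrite mem_enum inE => ? ->.
have me : mdeg m < e.+1 by rewrite ltnS les.
by exists (BMultinom me); rewrite ?mem_enum ?inE.
Qed.

(* The degree bound q only makes the list finite; it must dominate the degrees
   of all elements of gs. *)
Definition divisors r q (gs : seq 'X_{1..r}) : seq 'X_{1..r} :=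
  [seq bmnm m | m <- enum {: 'X_{1..r < q.+1}} & has (fun g => bmnm m <= g)%MM gs].

Lemma divisors_uniq r q (gs : seq 'X_{1..r}) : uniq (divisors q gs).
Proof.
by rewrite map_inj_uniq ?filter_uniq -?enumT ?enum_uniq //; apply: val_inj.
Qed.

Lemma lepm_mdeg r (m1 m2 : 'X_{1..r}) : (m1 <= m2)%MM -> mdeg m1 <= mdeg m2.
Proof. by move=> le12; apply/lemc_mdeg/lem_leo. Qed.

Lemma mem_divisors r q (gs : seq 'X_{1..r}) m :
  (forall g, g \in gs -> mdeg g <= q) ->
  (m \in divisors q gs) = has (fun g => m <= g)%MM gs.
Proof.
move=> degs; apply/mapP/idP => [[x] | /[dup] mgs /hasP[g gin mg]].
  by rewrite mem_filter => /andP[? _] ->.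
have mq : mdeg m < q.+1 by rewrite ltnS (leq_trans (lepm_mdeg mg)) ?degs.
by exists (BMultinom mq) => //; rewrite mem_filter mgs mem_enum.
Qed.

(** The divisors of a single [g] suffice for a lower bound: their exponents are chosen
    independently, the i-th among [(g i).+1] values. *)
Lemma prod_le_size_divisors r q (gs : seq 'X_{1..r}) g :
  (forall g, g \in gs -> mdeg g <= q) -> g \in gs ->
  \prod_(i < r) (g i).+1 <= size (divisors q gs).
Proof.
move=> degs gin.
pose F (f : {dffun forall i : 'I_r, 'I_(g i).+1}) := [multinom nat_of_ord (f i) | i < r].
have injF : injective F.
  move=> f1 f2 /mnmP eqF; apply/ffunP => i.
  by apply: val_inj; have := eqF i; rewrite !mnmE.
have -> : \prod_(i < r) (g i).+1 = size (map F (enum {: {dffun forall i : 'I_r, 'I_(g i).+1}})).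
  rewrite size_map -cardE card_dep_ffun foldrE big_map big_enum /=.
  by apply: eq_bigr => i _; rewrite card_ord.
apply: uniq_leq_size; first by rewrite map_inj_uniq ?enum_uniq.
move=> m /mapP[f _ ->]; rewrite mem_divisors //; apply/hasP; exists g => //.
by apply/mnm_lepP => i; rewrite mnmE -ltnS.
Qed.

(** * Divisors of the cube in small codegree *)

Definition cube r a : 'X_{1..r} := [multinom if l < 3 then a else 0 | l < r].

(* The divisors of the cube of codegree k; correct only for k <= a. *)
Definition cube_codivisors r a k : seq 'X_{1..r} :=
  [seq [multinom nth 0 [:: a - i; a - j; a - (k - i - j)] l | l < r]
  | i <- iota 0 k.+1, j <- iota 0 (k.+1 - i)].

Lemma size_cube_codivisors r a k :
  2 * size (cube_codivisors r a k) = k.+1 * k.+2.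
Proof.
rewrite size_allpairs_dep.
under eq_map do rewrite size_iota.
(* The last [n] rows of the triangle of pairs (i, j) have n, n - 1, ..., 1 entries, so the induction
   builds the triangle from its tip. *)
suff sum_tail n : n <= k.+1 ->
    2 * sumn [seq k.+1 - i | i <- iota (k.+1 - n) n] = n * n.+1.
  by have := sum_tail k.+1 (leqnn _); rewrite subnn.
elim: n => [|n IH] nk //=; have := IH (ltnW nk).
by rewrite (_ : (k.+1 - n.+1).+1 = k.+1 - n); lia.
Qed.

Lemma mdeg_support3 r (m : 'X_{1..r.+3}) :
  (forall l : 'I_r.+3, 3 <= l -> m l = 0) ->
  mdeg m = m (inord 0) + m (inord 1) + m (inord 2).
Proof.
move=> m0; rewrite mdegE !big_ord_recl big1 ?addn0 ?addnA.
  by congr (m _ + m _ + m _); apply: val_inj; rewrite /= inordK.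
by move=> i _; apply: m0.
Qed.

Lemma cube_codivisors_uniq r a k :
  k <= a -> uniq (cube_codivisors r.+3 a k).
Proof.
move=> ka; apply: allpairs_uniq_dep => [|i _|]; first exact: iota_uniq.
  exact: iota_uniq.
move=> [i j] [i' j'] /allpairsPdep[x [y [+ + [-> ->]]]].
move=> xk yk /allpairsPdep[x' [y' [+ + [-> ->]]]]; move: xk yk.
rewrite !mem_iota /= => ? ? ? ? /mnmP E.
have := E (inord 0); have := E (inord 1); rewrite !mnmE !inordK //= => ? ?.
by congr existT; lia.
Qed.

(** A divisor of the cube is determined by how far its three exponents fall short of [a]. In
    codegree [k] these deficits sum to [k], so [k <= a] keeps every subtraction from truncating. *)
Lemma mem_cube_codivisors r a k (m : 'X_{1..r.+3}) : k <= a ->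
  (m \in cube_codivisors r.+3 a k) = (mdeg m == 3 * a - k) && (m <= cube r.+3 a)%MM.
Proof.
move=> ka; apply/allpairsPdep/andP => [[i [j [+ + ->]]]|[/eqP + /mnm_lepP le]].
  rewrite !mem_iota /= => ? ?; split.
    rewrite mdeg_support3 => [|l l3]; rewrite !mnmE ?inordK //= ?nth_default //.
    lia.
  apply/mnm_lepP => l; rewrite !mnmE; case: ltnP => [|l3].
    by case: l => [[|[|[|l]]] ?] //= _; lia.
  by rewrite nth_default.
have le3 l : m l <= if l < 3 then a else 0 by have := le l; rewrite mnmE.
rewrite mdeg_support3 => [E|l l3]; last first.
  by have := le3 l; rewrite ltnNge l3 leqn0 => /eqP.
have := le3 (inord 0); have := le3 (inord 1); have := le3 (inord 2).
rewrite !inordK //= => ? ? ?.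
exists (a - m (inord 0)), (a - m (inord 1)).
split; [rewrite (mem_iota 0 k.+1); lia | rewrite mem_iota; lia |].
apply/mnmP => l; rewrite mnmE.
case: (ltnP l 3) => [|l3]; last first.
  by have := le3 l; rewrite ltnNge l3 leqn0 nth_default // => /eqP.
case: l => [[|[|[|l]]] ?] //= _.
- rewrite -(_ : inord 0 = Ordinal _); last by apply: val_inj; rewrite /= inordK.
  lia.
- rewrite -(_ : inord 1 = Ordinal _); last by apply: val_inj; rewrite /= inordK.
  lia.
- rewrite -(_ : inord 2 = Ordinal _); last by apply: val_inj; rewrite /= inordK.
  lia.
Qed.

(** This moves the counting from sets of bounded monomials to duplicate-free lists of plain ones. *)
Lemma card_dividing_monomials r e d (us s : seq 'X_{1..r}) : d <= e ->
  uniq s ->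
  (forall m, (m \in s) = (mdeg m == d) && has (fun u => m <= u)%MM us) ->
  (forall u, u \in us -> mdeg u <= e) ->
  #|dividing_monomials [set m : 'X_{1..r < e.+1} | bmnm m \in us] d| = size s.
Proof.
move=> de s_uniq sP usP; rewrite -(@card_bmnm_mem _ e) //; last first.
  by apply/allP => m; rewrite sP => /andP[/eqP->].
apply: eq_card => m; rewrite !inE sP; congr (_ && _).
apply/existsP/hasP => [[u]|[u uin mu]].
  by rewrite inE => /andP[? ?]; exists (bmnm u).
have ue : mdeg u < e.+1 by rewrite ltnS usP.
by exists (BMultinom ue); rewrite inE uin.
Qed.

Lemma mnm_le_mdeg r (m : 'X_{1..r}) c : m c <= mdeg m.
Proof. by rewrite mdegE (bigD1 c) //= leq_addr. Qed.

(** * Ridges, the generators g x_c^N, and their divisors *)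

Definition ridges r (W : seq 'I_r) (G : 'I_r -> seq 'X_{1..r}) N :=
  [seq (g + U_(c) *+ N)%MM | c <- W, g <- G c].

(** The part [n] free of x_c determines the divisor, since x_c fills up the degree; hence the length
    of this list does not depend on [d]. *)
Definition ridge_divisors r q (W : seq 'I_r) (G : 'I_r -> seq 'X_{1..r}) d :=
  [seq (n + U_(c) *+ (d - mdeg n))%MM | c <- W, n <- divisors q (G c)].

Definition ridge_data r q (W : seq 'I_r) (G : 'I_r -> seq 'X_{1..r}) : Prop :=
  [/\ uniq W, forall c, c \in W -> uniq (G c) &
      forall c g, c \in W -> g \in G c -> mdeg g = q /\ g c = 0].

Lemma mem_ridge_base r q W (G : 'I_r -> seq 'X_{1..r}) c n :
  ridge_data q W G -> c \in W -> n \in divisors q (G c) ->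
  mdeg n <= q /\ n c = 0.
Proof.
move=> [_ _ GP] cW; rewrite mem_divisors => [/hasP[g gG ng]|g gG].
  have [gq gc] := GP c g cW gG; split; first by rewrite -gq lepm_mdeg.
  by have /mnm_lepP/(_ c) := ng; rewrite gc leqn0 => /eqP.
by have [-> _] := GP c g cW gG.
Qed.

Lemma mnm_powE r (m : 'X_{1..r}) (c l : 'I_r) N :
  (m + U_(c) *+ N)%MM l = m l + (c == l) * N.
Proof. by rewrite mnmDE mulmnE mnm1E. Qed.

Lemma mdeg_pow r (m : 'X_{1..r}) c N : mdeg (m + U_(c) *+ N)%MM = mdeg m + N.
Proof. by rewrite mdegD mdegMn mdeg1 mul1n. Qed.

(** On the left x_c has exponent [d], above [q]; on the right every variable other than x_c' has
    exponent at most [q]. So c = c', and [n] and [n'] can be read off away from x_c. *)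
Lemma ridge_inj r q (c c' : 'I_r) n n' d d' : q < d ->
  mdeg n <= q -> n c = 0 -> mdeg n' <= q -> n' c' = 0 ->
  (n + U_(c) *+ d)%MM = (n' + U_(c') *+ d')%MM -> c = c' /\ n = n'.
Proof.
move=> qd nq nc n'q n'c' /mnmP E.
have ec : c = c'.
  apply/eqP; case: eqP => // /eqP cc'; have := E c.
  rewrite !mnm_powE eqxx eq_sym (negPf cc') nc.
  by have := mnm_le_mdeg n' c; lia.
split=> //; apply/mnmP => l; have := E l; rewrite !mnm_powE -ec.
case: (c =P l) => [<-|_]; last by rewrite !addn0.
by rewrite nc ec n'c'.
Qed.

Lemma ridge_divisors_uniq r q W (G : 'I_r -> seq 'X_{1..r}) d :
  ridge_data q W G -> 2 * q < d -> uniq (ridge_divisors q W G d).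
Proof.
move=> GP qd; have [W_uniq _ _] := GP.
apply: allpairs_uniq_dep => // [c _|]; first exact: divisors_uniq.
move=> [c n] [c' n'] /allpairsPdep[x [y [xW yG [-> ->]]]].
move=> /allpairsPdep[x' [y' [x'W y'G [-> ->]]]] /= E.
have [yq yx] := mem_ridge_base GP xW yG.
have [y'q y'x'] := mem_ridge_base GP x'W y'G.
(* The exponent [d - mdeg y] exceeds [q] because [mdeg y <= q] and [2 * q < d]. *)
by have [|-> ->] := ridge_inj _ yq yx y'q y'x' E; first lia.
Qed.

(** The bound [q <= d] keeps [d - mdeg n] from truncating, and [d <= N] keeps this exponent of x_c
    within that of the ridge. *)
Lemma mem_ridge_divisors r q W (G : 'I_r -> seq 'X_{1..r}) N d m :
  ridge_data q W G -> q <= d <= N ->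
  (m \in ridge_divisors q W G d) =
  (mdeg m == d) && has (fun u => m <= u)%MM (ridges W G N).
Proof.
move=> GP /andP[qd dN].
have GPq c g : c \in W -> g \in G c -> mdeg g <= q.
  by move=> cW gG; have [_ _ /(_ c g cW gG) [->]] := GP.
apply/allpairsPdep/andP => [[c [n [cW nG ->]]]|].
  have [nq nc] := mem_ridge_base GP cW nG; split.
    by rewrite mdeg_pow; lia.
  move: nG; rewrite mem_divisors; last by move=> g'; apply: GPq.
  case/hasP => g gG /mnm_lepP ng; apply/hasP; exists (g + U_(c) *+ N)%MM.
    by apply/allpairsPdep; exists c, g.
  by apply/mnm_lepP => l; rewrite !mnm_powE leq_add ?leq_mul //; lia.
case=> /eqP md /hasP[_ /allpairsPdep[c [g [cW gG ->]]] /mnm_lepP mg].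
have [_ _ /(_ c g cW gG) [gq gc]] := GP.
(* [n] is [m] with its power of x_c removed. *)
pose n := [multinom (c != l) * m l | l < r].
have mE : m = (n + U_(c) *+ m c)%MM.
  apply/mnmP => l; rewrite mnm_powE mnmE.
  by case: eqP => [<-|_]; rewrite ?mul0n ?mul1n ?addn0.
have nd : d - mdeg n = m c by rewrite -md {1}mE mdeg_pow; lia.
exists c, n; rewrite nd; split=> //.
rewrite mem_divisors; last by move=> g'; apply: (GPq c).
apply/hasP; exists g => //; apply/mnm_lepP => l; rewrite mnmE.
have := mg l; rewrite mnm_powE; case: eqP => // _; by rewrite mul1n addn0.
Qed.

(** * The sequence generated by the cube and the ridges *)

Definition cube_ridges r q a (W : seq 'I_r) (G : 'I_r -> seq 'X_{1..r}) :=
  cube r a :: ridges W G (3 * a - q).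

Lemma mdeg_cube r a : mdeg (cube r.+3 a) = 3 * a.
Proof.
rewrite mdeg_support3 => [|l l3]; rewrite !mnmE ?inordK //=; first lia.
by rewrite ltnNge l3.
Qed.

Lemma mdeg_cube_ridges r q a (W : seq 'I_r.+3) G u :
  ridge_data q W G -> q <= a -> u \in cube_ridges q a W G -> mdeg u = 3 * a.
Proof.
move=> [_ _ GP] qa; rewrite inE => /predU1P[->|]; first exact: mdeg_cube.
case/allpairsPdep => c [g [cW gG ->]]; have [gq _] := GP c g cW gG.
by rewrite mdeg_pow; lia.
Qed.

Lemma cube_ridges_uniq r q a (W : seq 'I_r.+3) G :
  ridge_data q W G -> 2 * q + 4 <= a -> uniq (cube_ridges q a W G).
Proof.
move=> GP qa; have [W_uniq G_uniq GPc] := GP; apply/andP; split.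
  apply/negP => /allpairsPdep[c [g [cW gG /mnmP/(_ c)]]].
  by rewrite mnm_powE mnmE eqxx mul1n; case: ifP; lia.
apply: allpairs_uniq_dep => //.
move=> [c g] [c' g'] /allpairsPdep[x [y [xW yG [-> ->]]]].
move=> /allpairsPdep[x' [y' [x'W y'G [-> ->]]]] /= E.
have [yq yx] := GPc _ _ xW yG; have [y'q y'x'] := GPc _ _ x'W y'G.
have [|||-> ->//] := @ridge_inj _ q _ _ _ _ _ _ _ _ yx _ y'x' E.
- by lia.
- by rewrite yq.
- by rewrite y'q.
Qed.

(** In these degrees a ridge divisor has x_c-exponent at least 3a - k - q > a, so it does not divide
    the cube and the two counts add up. *)
Lemma card_dividing_cube_ridges r q a k (W : seq 'I_r.+3) G :
  ridge_data q W G -> 2 * q + 4 <= a -> q <= k <= q + 2 ->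
  2 * #|dividing_monomials
         [set m : 'X_{1..r.+3 < (3 * a).+1} | bmnm m \in cube_ridges q a W G]
         (3 * a - k)| =
  k.+1 * k.+2 + 2 * sumn [seq size (divisors q (G c)) | c <- W].
Proof.
move=> GP qa /andP[qk kq]; have [W_uniq _ GPc] := GP.
rewrite (@card_dividing_monomials _ _ _ _ (cube_codivisors r.+3 a k ++
  ridge_divisors q W G (3 * a - k))).
- by rewrite size_cat mulnDr size_cube_codivisors size_allpairs_dep.
- by lia.
- rewrite cat_uniq cube_codivisors_uniq ?ridge_divisors_uniq //=; try lia.
  rewrite andbT; apply/hasPn => _ /allpairsPdep[c [n [cW nG ->]]] /=.
  rewrite mem_cube_codivisors; last by lia.
  rewrite negb_and; apply/orP; right; apply/negP => /mnm_lepP/(_ c).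
  rewrite mnm_powE mnmE eqxx.
  by have [nq nc] := mem_ridge_base GP cW nG; case: ifP; lia.
- move=> m; rewrite mem_cat mem_cube_codivisors; last by lia.
  rewrite (@mem_ridge_divisors _ _ _ _ (3 * a - q)) //; last by lia.
  by rewrite /= andb_orr.
- by move=> u /(mdeg_cube_ridges GP)->; lia.
Qed.

Lemma lepm_mdeg_eq r (m1 m2 : 'X_{1..r}) :
  (m1 <= m2)%MM -> mdeg m1 = mdeg m2 -> m1 = m2.
Proof.
move=> le12 e12; have := submK le12 => E.
have : mdeg (m2 - m1)%MM = 0 by have := congr1 mdeg E; rewrite mdegD; lia.
by move/eqP; rewrite mdeg_eq0 => /eqP z; rewrite -E z add0m.
Qed.

Definition cube_ridge_sequence r q a (W : seq 'I_r) G : seq nat :=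
  mkseq (fun i => #|dividing_monomials
    [set m : 'X_{1..r < (3 * a).+1} | bmnm m \in cube_ridges q a W G] i|)
  (3 * a).+1.

Lemma cube_ridge_sequence_pure r q t a (W : seq 'I_r.+3) G :
  ridge_data q W G -> 2 * q + 4 <= a ->
  t = (sumn [seq size (G c) | c <- W]).+1 ->
  (forall l, has (fun u : 'X_{1..r.+3} => u l != 0) (cube_ridges q a W G)) ->
  is_pure_O_sequence r.+3 t (3 * a) (cube_ridge_sequence q a W G).
Proof.
move=> GP qa tE vars.
have us_deg u : u \in cube_ridges q a W G -> mdeg u = 3 * a.
  by apply: mdeg_cube_ridges GP _; lia.
have us_le u : u \in cube_ridges q a W G -> mdeg u <= 3 * a.
  by move/us_deg->.
have us_uniq := cube_ridges_uniq GP qa.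
have us_size : size (cube_ridges q a W G) = t.
  by rewrite /= size_allpairs_dep tE.
have hE i : i <= 3 * a -> nth 0 (cube_ridge_sequence q a W G) i =
    #|dividing_monomials [set m : 'X_{1..r.+3 < (3 * a).+1} |
        bmnm m \in cube_ridges q a W G] i|.
  by move=> ia; rewrite nth_mkseq.
split.
- lia.
- by rewrite size_mkseq.
- move=> i ia; rewrite hE // card_gt0; apply/set0Pn.
  (* Degree [i] is filled greedily by x_0, then x_1, then x_2, each up to [a]; truncated subtraction
     gives 0 for the variables not reached. *)
  pose m : 'X_{1..r.+3} :=
    [multinom nth 0 [:: minn i a; minn (i - a) a; i - 2 * a] l | l < r.+3].
  have mi : mdeg m = i.
    rewrite mdeg_support3 => [|l l3]; rewrite !mnmE ?inordK //=; first lia.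
    by rewrite nth_default.
  have mlt : mdeg m < (3 * a).+1 by rewrite mi.
  have clt : mdeg (cube r.+3 a) < (3 * a).+1 by rewrite mdeg_cube.
  exists (BMultinom mlt); rewrite inE /= mi eqxx /=; apply/existsP.
  exists (BMultinom clt); rewrite inE /= in_cons eqxx /=.
  apply/mnm_lepP => l; rewrite !mnmE; case: ltnP => [|l3].
    by case: l => [[|[|[|l]]] ?] //= _; lia.
  by rewrite nth_default.
- rewrite !hE //; try lia; split.
  + rewrite (@card_dividing_monomials _ _ _ _ [:: 0%MM]) // => m.
    rewrite inE mdeg_eq0; case: eqP => //= ->; symmetry; apply/orP; left.
    by apply/mnm_lepP => l; rewrite mnm0E.
  + rewrite (@card_dividing_monomials _ _ _ _
      [seq U_(l)%MM | l <- enum 'I_r.+3]) //; last first.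
    * move=> m; apply/mapP/andP => [[l _ ->]|[/mdeg1P[l /eqP->] _]].
        by rewrite mdeg1 (eq_has (lep1mP l)).
      by exists l => //; rewrite mem_enum.
    * rewrite map_inj_uniq ?enum_uniq // => l l' /eqP.
      by rewrite eq_mnm1 => /eqP.
    * lia.
    by rewrite size_map size_enum_ord.
  (* In top degree a divisor of a generator equals that generator. *)
  + rewrite (@card_dividing_monomials _ _ _ _ (cube_ridges q a W G)) // => m.
    apply/idP/andP => [min|[/eqP md /hasP[u uin mu]]].
      by rewrite us_deg //; split=> //; apply/hasP; exists m; rewrite ?lepm_refl.
    by rewrite (lepm_mdeg_eq mu) // md us_deg.
exists [set m : 'X_{1..r.+3 < (3 * a).+1} | bmnm m \in cube_ridges q a W G].
split=> //.
- by rewrite card_bmnm_mem //; apply/allP => u /us_le.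
- by move=> m; rewrite inE => /us_deg.
Qed.

(** Since 2T = (q + 2)(q + 3), the outer product (T + q + 3 + C)(T - q - 2 + C) equals (T + C)^2 +
    (C - T). *)
Lemma cube_ridge_sequence_not_log_concave r q a (W : seq 'I_r.+3) G :
  ridge_data q W G -> 2 * q + 4 <= a ->
  (q + 2) * (q + 3) < 2 * sumn [seq size (divisors q (G c)) | c <- W] ->
  ~ log_concave (nth 0 (cube_ridge_sequence q a W G)).
Proof.
move=> GP qa big /(_ (3 * a - q.+1)).
have H k := @card_dividing_cube_ridges _ _ _ k _ _ GP qa.
have -> : (3 * a - q.+1).-1 = 3 * a - q.+2 by lia.
have -> : (3 * a - q.+1).+1 = 3 * a - q by lia.
rewrite !nth_mkseq; try lia.
have := H q; have := H q.+1; have := H q.+2.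
move: (sumn _) big => C big.
case: #|_| => [|h2]; case: #|_| => [|h1]; case: #|_| => [|h0]; nia.
Qed.

(** * Infinite families and the choice of generators *)

Lemma infinite_set_injective (T : Type) (A : set T) (f : nat -> T) :
  injective f -> (forall n, A (f n)) -> infinite_set A.
Proof.
move=> inj_f fA finA; apply: infinite_nat.
apply: (sub_finite_set (B := (f @^-1` A)%classic)) => [n _|]; first exact: fA.
by apply: finite_preimage finA => m n _ _; apply: inj_f.
Qed.

(** Different values of [a] give sequences of different lengths 3a + 1, so a single choice of [W]
    and [G] yields an infinite family. *)
Lemma infinite_cube_ridges r q t (W : seq 'I_r.+3) G :
  ridge_data q W G ->
  (q + 2) * (q + 3) < 2 * sumn [seq size (divisors q (G c)) | c <- W] ->
  t = (sumn [seq size (G c) | c <- W]).+1 ->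
  (forall a l, q < a ->
     has (fun u : 'X_{1..r.+3} => u l != 0) (cube_ridges q a W G)) ->
  infinite_set (non_log_concave_pure_O_sequences r.+3 t).
Proof.
move=> GP big tE vars.
apply: (@infinite_set_injective _ _
  (fun n => cube_ridge_sequence q (n + (2 * q + 4)) W G)).
 by move=> m n /(congr1 size); rewrite /cube_ridge_sequence !size_mkseq; lia.
move=> n; split; last first.
  by apply: cube_ridge_sequence_not_log_concave; rewrite ?leq_addl.
exists (3 * (n + (2 * q + 4))); apply: cube_ridge_sequence_pure => //.
  by rewrite leq_addl.
by move=> l; apply: vars; lia.
Qed.

Theorem theorem8 :
  infinite_set (non_log_concave_pure_O_sequences 3 4) /\
  (forall r t : nat, 4 <= r -> 2 <= t <= r.+1 ->
     infinite_set (non_log_concave_pure_O_sequences r t)).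
Proof.
split.
  pose g (c : 'I_3) : 'X_{1..3} := [multinom (c != l) : nat | l < 3].
  have g_deg c : mdeg (g c) = 2.
    by rewrite mdegE !big_ord_recl big_ord0 !mnmE; case: c => [[|[|[|]]]].
  have gsP c x : x \in [:: g c] -> mdeg x = 2 /\ x c = 0.
    by rewrite inE => /eqP->; rewrite g_deg mnmE eqxx.
  apply: (@infinite_cube_ridges 0 2 4 (enum 'I_3) (fun c => [:: g c])).
  - by split=> [||c x _ /gsP //]; rewrite ?enum_uniq.
  - have big c : 4 <= size (divisors 2 [:: g c]).
      apply: leq_trans (prod_le_size_divisors _ (mem_head (g c) [::])).
        by rewrite !big_ord_recl big_ord0 !mnmE; case: c => [[|[|[|]]]].
      by move=> x /gsP[->].
    rewrite sumnE big_map big_enum /= !big_ord_recl big_ord0.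
    have := big ord0; have := big (lift ord0 ord0).
    have := big (lift ord0 (lift ord0 ord0)); lia.
  - by rewrite sumnE big_map big_enum /= sum1_card card_ord.
  - by move=> a l qa; rewrite /= mnmE ltn_ord -lt0n; apply/orP; left; lia.
(* The codimension is now [r.+4] and the type [t.+2], so [t.+1] ridges are needed beside the
   cube. *)
move=> [|[|[|[|r]]]] // [|[|t]] // _ tr.
(* The summand r + t gives q + 3 <= 4p, and the summand 20 gives 16p^2 < 2p^3. *)
pose p := r + t + 20.
pose v3 : 'I_r.+4 := inord 3.
(* Shifting exponents between x_0 and x_1 gives distinct monomials of equal degree. The default 1 of
   [nth] makes every x_l with l >= 4 occur. *)
pose g j : 'X_{1..r.+4} :=
  [multinom nth 1 [:: p + j; p + (t - j); p; 0] l | l < r.+4].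
pose q := 3 * p + t + r.
have g_deg j : j <= t -> mdeg (g j) = q.
  move=> jt; rewrite mdegE !big_ord_recl !mnmE /=.
  rewrite (eq_bigr (fun=> 1)) => [|i _]; last by rewrite mnmE /= nth_nil.
  by rewrite sum1_card card_ord; lia.
have gsP x : x \in [seq g j | j <- iota 0 t.+1] -> mdeg x = q /\ x v3 = 0.
  case/mapP => j; rewrite (mem_iota 0 t.+1) => jt ->.
  by rewrite g_deg; last lia; rewrite mnmE inordK.
have g0 : g 0 \in [seq g j | j <- iota 0 t.+1] by rewrite /= mem_head.
apply: (@infinite_cube_ridges r.+1 q _ [:: v3]
  (fun=> [seq g j | j <- iota 0 t.+1])).
- split=> // [_ _|c x].
    rewrite map_inj_uniq ?iota_uniq // => j j' /mnmP/(_ (inord 0)).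
    by rewrite !mnmE inordK //= => /addnI.
  by rewrite inE => /eqP-> /gsP.
- rewrite [sumn _]addn0.
  have : p ^ 3 <= size (divisors q [seq g j | j <- iota 0 t.+1]).
    apply: leq_trans (prod_le_size_divisors _ g0); last by move=> x /gsP[->].
    rewrite !big_ord_recl !mnmE /= mul1n.
    have : 0 < \prod_(i < r) (g 0 (lift ord0 (lift ord0 (lift ord0 (lift ord0 i))))).+1.
      by apply: prodn_gt0.
    by move: (\prod_(i < r) _) => P; rewrite /expn /=; nia.
  have : (q + 2) * (q + 3) < 2 * p ^ 3.
    have qp : q + 3 <= 4 * p by lia.
    have p20 : 20 <= p by lia.
    have : (q + 2) * (q + 3) < 16 * p ^ 2 by rewrite expnS expn1; nia.
    by rewrite (expnS p 2); nia.
  lia.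
- by rewrite [sumn _]addn0 size_map size_iota.
(* The cube contains x_0, x_1, x_2; the ridge over [g 0] contains x_3 by its large power and the
   later variables through [g 0]. *)
- move=> a l qa; apply/hasP; case: (ltnP l 3) => l3.
    by exists (cube r.+4 a); rewrite ?mem_head // mnmE l3; lia.
  exists (g 0%N + U_(v3) *+ (3 * a - q))%MM.
    rewrite inE; apply/orP; right; apply/allpairsPdep.
    by exists v3, (g 0); split=> //; apply: mem_head.
  rewrite mnm_powE mnmE; case: (v3 =P l) => [_|/eqP].
    by rewrite mul1n -lt0n addn_gt0 subn_gt0; apply/orP; right; lia.
  rewrite -val_eqE /= inordK // => l3'; rewrite nth_default //=.
  by rewrite ltn_neqAle l3'.
Qed.
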